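(* Let $\langle\mathbf{A}_{\mathrm d},\mathbf{A},\iota\rangle$ be a distributively generated (generalized) additive quantale with multiplication. An $\mathbf{A}$-module $\mathbf{Q}$ is cyclic if and only if it is isomorphic to an $\mathbf{A}$-module of the form $\mathbf{A}_\gamma$ for some structural nucleus $\gamma$ on $\mathbf{A}$.
   Context: Fix one of two parallel settings: plain (''joins'' = joins of arbitrary families) or generalized (''joins'' = joins of non-empty families). A (generalized) quantale is $\langle Q,\bigvee,+,\mathsf{0}\rangle$ with $Q$ a poset having all such joins, $\langle Q,+,\mathsf{0}\rangle$ a monoid with $+$ order-preserving and distributing over such joins on both sides. A (generalized) additive quantale with multiplication is a triple $\langle\mathbf{A}_{\mathrm d},\mathbf{A},\iota\rangle$: $\mathbf{A}_{\mathrm d}$ a monoid, $\mathbf{A}$ a (generalized) quantale with an additional monoid structure $\langle A,\cdot,\mathsf 1\rangle$, $\iota$ a monoid homomorphism, such that $(\bigvee_i a_i)\cdot b=\bigvee_i(a_i\cdot b)$, $(a+b)\cdot c=a\cdot c+b\cdot c$, $\mathsf0\cdot a=\mathsf0$, and for $d\in\mathbf{A}_{\mathrm d}$ left multiplication by $\iota(d)$ preserves joins, $+$, $\mathsf0$; distributively generated means $\mathbf{A}$ is generated as a (generalized) quantale by $\iota[\mathbf{A}_{\mathrm d}]$. An $\mathbf{A}$-module is a (generalized) quantale $\mathbf{Q}$ with $\ast\colon A\times Q\to Q$, order-preserving in both coordinates, with $(a\cdot b)\ast x=a\ast(b\ast x)$, $\mathsf1\ast x=x$, $(a+b)\ast x=a\ast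 x+b\ast x$, $\mathsf0\ast x=\mathsf0$, $(\bigvee_i a_i)\ast x=\bigvee_i(a_i\ast x)$, and $x\mapsto\iota(d)\ast x$ preserving $+$, $\mathsf0$, joins for $d\in\mathbf{A}_{\mathrm d}$. $\mathbf{Q}$ is cyclic if $Q=\{a\ast u:a\in A\}$ for some $u\in Q$. $\mathbf{A}$ is an $\mathbf{A}$-module via $a\ast x=a\cdot x$. A structural nucleus on a module is an order-preserving, expansive, idempotent $\gamma$ with $\gamma(x)+\gamma(y)\le\gamma(x+y)$ and $a\ast\gamma(x)\le\gamma(a\ast x)$ for all $a\in A$. $\mathbf{A}_\gamma$ is the module on $\gamma[A]$ with $\bigvee_\gamma X=\gamma(\bigvee X)$, $x+_\gamma y=\gamma(x+y)$, $\mathsf0_\gamma=\gamma(\mathsf0)$, $a\ast_\gamma x=\gamma(a\cdot x)$. *)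

(* Defs.v *)
From HB Require Import structures.
From mathcomp Require Import all_boot all_order.
From mathcomp Require Import monoid boolp classical_sets.

Set Implicit Arguments.
Unset Strict Implicit.
Unset Printing Implicit Defensive.

Import Order.TTheory.
Local Open Scope classical_set_scope.
Local Open Scope group_scope.
Local Open Scope order_scope.

(* The two parallel settings: joins of arbitrary families, or joins of
   non-empty families only. *)
Variant setting := Plain | Generalized.

Definition joinable (s : setting) (T : Type) (X : set T) : Prop :=
  if s is Generalized then X !=set0 else True.

Declare Scope quantale_scope.
Delimit Scope quantale_scope with qt.
Local Open Scope quantale_scope.

Reserved Notation "a *: x" (at level 40).

(* [qjoin] is a total function, but it is only specified on [joinable] sets:
   its value at [set0] in the [Generalized] setting is irrelevant, and nothing
   below refers to it. *)
HB.mixin Record isQuantale (s : setting) (d : Order.disp_t) Q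
    of Order.POrder d Q := {
  qjoin : set Q -> Q;
  qadd : Q -> Q -> Q;
  qzero : Q;
  qjoinP : forall X : set Q, joinable s X -> supremums X (qjoin X);
  qaddA : associative qadd;
  qadd0l : left_id qzero qadd;
  qadd0r : right_id qzero qadd;
  le_qadd : forall x x' y y' : Q, x <= x' -> y <= y' -> qadd x y <= qadd x' y';
  qjoinDl : forall (X : set Q) (y : Q), joinable s X ->
    qadd (qjoin X) y = qjoin [set qadd x y | x in X];
  qjoinDr : forall (X : set Q) (y : Q), joinable s X ->
    qadd y (qjoin X) = qjoin [set qadd y x | x in X]
}.

#[short(type="quantaleType")]
HB.structure Definition Quantale (s : setting) (d : Order.disp_t) :=
  { Q of isQuantale s d Q & Order.POrder d Q }.

Arguments qjoin {s d Q} X : rename.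
Arguments qadd {s d Q} x y : rename.
Arguments qzero {s d Q} : rename.

Notation "x + y" := (qadd x y) : quantale_scope.
Notation "0" := qzero : quantale_scope.

Definition subquantale (s : setting) (d : Order.disp_t) (Q : quantaleType s d)
    (S : set Q) : Prop :=
  [/\ S 0,
      forall x y, S x -> S y -> S (x + y)
    & forall X : set Q, joinable s X -> X `<=` S -> S (qjoin X)].

(* The triple <Ad, A, iota>: the second monoid structure of A is that of
   [monoidType], and iota is part of the structure carried by A. *)
HB.mixin Record isAdditiveQuantale (Ad : monoidType) (s : setting)
    (d : Order.disp_t) A of Quantale s d A & Monoid A := {
  iota : Ad -> A;
  iota_morph : monoid_morphism iota;
  qjoinMl : forall (X : set A) (b : A), joinable s X ->
    qjoin X * b = qjoin [set a * b | a in X];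
  qaddMl : forall a b c : A, (a + b) * c = a * c + b * c;
  q0Ml : forall a : A, (0 : A) * a = 0;
  iotaM_join : forall (e : Ad) (X : set A), joinable s X ->
    iota e * qjoin X = qjoin [set iota e * x | x in X];
  iotaM_add : forall (e : Ad) (x y : A),
    iota e * (x + y) = iota e * x + iota e * y;
  iotaM_0 : forall e : Ad, iota e * (0 : A) = 0
}.

#[short(type="additiveQuantaleType")]
HB.structure Definition AdditiveQuantale (Ad : monoidType) (s : setting)
    (d : Order.disp_t) :=
  { A of isAdditiveQuantale Ad s d A & Quantale s d A & Monoid A }.

Arguments iota {Ad s d A} e : rename.

HB.mixin Record isDistrGenerated (Ad : monoidType) (s : setting)
    (d : Order.disp_t) A of AdditiveQuantale Ad s d A := {
  distr_generated :
    smallest (@subquantale s d A) (range (@iota Ad s d A)) = [set: A]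
}.

#[short(type="dgAdditiveQuantaleType")]
HB.structure Definition DGAdditiveQuantale (Ad : monoidType) (s : setting)
    (d : Order.disp_t) :=
  { A of isDistrGenerated Ad s d A & AdditiveQuantale Ad s d A }.

HB.mixin Record isModule (Ad : monoidType) (s : setting) (dA : Order.disp_t)
    (A : additiveQuantaleType Ad s dA) (d : Order.disp_t) Q
    of Quantale s d Q := {
  act : A -> Q -> Q;
  le_act : forall (a b : A) (x y : Q), a <= b -> x <= y -> act a x <= act b y;
  actM : forall (a b : A) (x : Q), act (a * b) x = act a (act b x);
  act1 : forall x : Q, act (1 : A) x = x;
  actDl : forall (a b : A) (x : Q), act (a + b) x = act a x + act b x;
  act0 : forall x : Q, act (0 : A) x = 0;
  act_joinl : forall (X : set A) (x : Q), joinable s X ->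
    act (qjoin X) x = qjoin [set act a x | a in X];
  act_iotaD : forall (e : Ad) (x y : Q),
    act (iota e) (x + y) = act (iota e) x + act (iota e) y;
  act_iota0 : forall e : Ad, act (iota e) (0 : Q) = 0;
  act_iota_join : forall (e : Ad) (X : set Q), joinable s X ->
    act (iota e) (qjoin X) = qjoin [set act (iota e) x | x in X]
}.

#[short(type="moduleType")]
HB.structure Definition Module (Ad : monoidType) (s : setting)
    (dA : Order.disp_t) (A : additiveQuantaleType Ad s dA)
    (d : Order.disp_t) :=
  { Q of isModule Ad s dA A d Q & Quantale s d Q }.

Arguments act {Ad s dA A d Q} a x : rename.

Notation "a *: x" := (act a x) : quantale_scope.

Definition cyclic (Ad : monoidType) (s : setting) (dA : Order.disp_t)
    (A : additiveQuantaleType Ad s dA) (d : Order.disp_t)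
    (Q : moduleType A d) : Prop :=
  exists u : Q, range (fun a : A => a *: u) = [set: Q].

Record module_iso (Ad : monoidType) (s : setting) (dA : Order.disp_t)
    (A : additiveQuantaleType Ad s dA) (d d' : Order.disp_t)
    (Q : moduleType A d) (Q' : moduleType A d') (f : Q -> Q') : Prop :=
  ModuleIso {
  module_iso_bij : bijective f;
  module_iso_le : {mono f : x y / x <= y};
  module_iso_join : forall X : set Q, joinable s X ->
    f (qjoin X) = qjoin (f @` X);
  module_iso_add : {morph f : x y / x + y};
  module_iso_zero : f 0 = 0;
  module_iso_act : forall (a : A) (x : Q), f (a *: x) = a *: f x
}.

Definition isomorphic (Ad : monoidType) (s : setting) (dA : Order.disp_t)
    (A : additiveQuantaleType Ad s dA) (d d' : Order.disp_t)
    (Q : moduleType A d) (Q' : moduleType A d') : Prop :=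
  exists f : Q -> Q', module_iso f.

Record structural_nucleus (Ad : monoidType) (s : setting) (dA : Order.disp_t)
    (A : additiveQuantaleType Ad s dA) (d : Order.disp_t)
    (Q : moduleType A d) := StructuralNucleus {
  nucleus :> Q -> Q;
  nucleus_le : {homo nucleus : x y / x <= y};
  nucleus_ge : forall x : Q, x <= nucleus x;
  nucleus_idem : forall x : Q, nucleus (nucleus x) = nucleus x;
  nucleus_add : forall x y : Q, nucleus x + nucleus y <= nucleus (x + y);
  nucleus_act : forall (a : A) (x : Q), a *: nucleus x <= nucleus (a *: x)
}.

Section QuantaleTheory.
Context (s : setting) (d : Order.disp_t) (Q : quantaleType s d).
Implicit Types (X Y : set Q) (x y : Q).

Lemma joinable_image (T U : Type) (f : T -> U) (X : set T) :
  joinable s X -> joinable s (f @` X).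
Proof. by case: s => //= -[x Xx]; exists (f x), x. Qed.

Lemma joinable2 (T : Type) (x y : T) : joinable s [set x; y].
Proof. by case: s => //=; exists x; left. Qed.

Lemma le_qjoin X x : joinable s X -> X x -> x <= qjoin X.
Proof. by move=> /qjoinP[ub _]; exact: ub. Qed.

Lemma qjoin_le X y : joinable s X -> (forall x, X x -> x <= y) -> qjoin X <= y.
Proof. by move=> /qjoinP[_ lb] Xy; exact: lb. Qed.

End QuantaleTheory.

(* The definition of an additive quantale with multiplication does not require
   a * x to be monotone in x for every a; this holds when A is distributively
   generated, which is what makes A a module over itself. *)
Section RegularModule.
Context (Ad : monoidType) (s : setting) (d : Order.disp_t).
Context (A : dgAdditiveQuantaleType Ad s d).

Lemma le_mulql (a b x : A) : a <= b -> a * x <= b * x.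
Proof.
move=> ab.
have jP := joinable2 s a b.
have <- : qjoin [set a; b] = b.
  apply/le_anti/andP; split; last by apply: le_qjoin => //; right.
  by apply: qjoin_le => // y [->|->].
rewrite qjoinMl//; apply: le_qjoin; first exact: joinable_image.
by exists a => //; left.
Qed.

Lemma le_mulqr (a x y : A) : x <= y -> a * x <= a * y.
Proof.
move=> xy.
have : smallest (@subquantale s d A) (range (@iota Ad s d A)) a.
  by rewrite distr_generated.
move/(_ [set b | b * x <= b * y]); apply; split; last first.
  move=> _ [e _ <-] /=.
  have jP := joinable2 s x y.
  have <- : qjoin [set x; y] = y.
    apply/le_anti/andP; split; last by apply: le_qjoin => //; right.
    by apply: qjoin_le => // z [->|->].
  rewrite iotaM_join//; apply: le_qjoin; first exact: joinable_image.
  by exists x => //; left.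
split => [|b c bxy cxy|X jX Xxy] /=.
- by rewrite !q0Ml.
- by rewrite !qaddMl; exact: le_qadd.
- rewrite !qjoinMl//; apply: qjoin_le; first exact: joinable_image.
  move=> _ [b Xb <-]; apply: (le_trans (Xxy b Xb)).
  by apply: le_qjoin; [exact: joinable_image|exists b].
Qed.

Lemma le_mulq (a b x y : A) : a <= b -> x <= y -> a * x <= b * y.
Proof. by move=> ab xy; exact: le_trans (le_mulql _ ab) (le_mulqr _ xy). Qed.

Definition regular_module : Type := A.

HB.instance Definition _ := Quantale.copy regular_module A.

HB.instance Definition _ :=
  isModule.Build Ad s d A d regular_module le_mulq
    (fun a b x => esym (mulgA a b x)) (@mul1g A) (@qaddMl Ad s d A)
    (@q0Ml Ad s d A) (@qjoinMl Ad s d A) (@iotaM_add Ad s d A)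
    (@iotaM_0 Ad s d A) (@iotaM_join Ad s d A).

End RegularModule.

Section NucleusImage.
Context (Ad : monoidType) (s : setting) (dA : Order.disp_t).
Context (A : additiveQuantaleType Ad s dA) (d : Order.disp_t).
Context (Q : moduleType A d) (g : structural_nucleus Q).

Definition nucleus_image : Type := set_type (range g).

HB.instance Definition _ := SubChoice.on nucleus_image.
HB.instance Definition _ :=
  [SubChoice_isSubPOrder of nucleus_image by <: with d].

Lemma le_nucleus_imageE (x y : nucleus_image) :
  (x <= y) = (val x <= val y :> Q).
Proof. by rewrite Order.le_val. Qed.

Lemma nucleus_in (x : Q) : g x \in range g.
Proof. by apply/mem_set; exists x. Qed.

Definition nucleus_proj (x : Q) : nucleus_image := SigSub (nucleus_in x).

Definition nucleus_join (X : set nucleus_image) : nucleus_image :=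
  nucleus_proj (qjoin [set val x | x in X]).
Definition nucleus_plus (x y : nucleus_image) : nucleus_image :=
  nucleus_proj (val x + val y).
Definition nucleus_zero : nucleus_image := nucleus_proj 0.
Definition nucleus_scale (a : A) (x : nucleus_image) : nucleus_image :=
  nucleus_proj (a *: val x).

Lemma nucleus_fix (x : nucleus_image) : g (val x) = val x.
Proof. by case: x => x /= /set_mem[y _ <-]; rewrite nucleus_idem. Qed.

Lemma nucleus_lel (x y : Q) : x <= g y -> g x <= g y.
Proof. by move=> /(nucleus_le g); rewrite nucleus_idem. Qed.

Lemma nucleus_addE (x y : Q) : g (g x + g y) = g (x + y).
Proof.
apply/le_anti/andP; split; first exact/nucleus_lel/nucleus_add.
by apply: nucleus_le; apply: le_qadd; exact: nucleus_ge.
Qed.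

Lemma nucleus_actE (a : A) (x : Q) : g (a *: g x) = g (a *: x).
Proof.
apply/le_anti/andP; split; first exact/nucleus_lel/nucleus_act.
by apply: nucleus_le; apply: le_act => //; exact: nucleus_ge.
Qed.

Lemma nucleus_joinE (X : set Q) : joinable s X ->
  g (qjoin (g @` X)) = g (qjoin X).
Proof.
move=> jX; have jgX := joinable_image g jX.
apply/le_anti/andP; split; apply: nucleus_lel; apply: qjoin_le => //.
  by move=> _ [x Xx <-]; apply: nucleus_le; exact: le_qjoin.
move=> x Xx; apply: le_trans (nucleus_ge g _).
by apply: le_trans (nucleus_ge g x) _; apply: le_qjoin => //; exists x.
Qed.

Lemma nucleus_joinP (X : set nucleus_image) : joinable s X ->
  supremums X (nucleus_join X).
Proof.
move=> jX; have jvX := joinable_image (val : nucleus_image -> Q) jX.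
split=> [x Xx|y Xy] /=; rewrite le_nucleus_imageE.
  by apply: le_trans (nucleus_ge g _); apply: le_qjoin => //; exists x.
rewrite -(nucleus_fix y); apply: nucleus_lel; rewrite nucleus_fix.
by apply: qjoin_le => // _ [x Xx <-]; rewrite -le_nucleus_imageE; exact: Xy.
Qed.

Lemma nucleus_plusA : associative nucleus_plus.
Proof.
move=> x y z; apply: val_inj => /=.
rewrite -[in LHS](nucleus_fix x) -[in RHS](nucleus_fix z).
by rewrite !nucleus_addE qaddA.
Qed.

Lemma nucleus_plus0l : left_id nucleus_zero nucleus_plus.
Proof.
move=> x; apply: val_inj => /=.
by rewrite -[in LHS](nucleus_fix x) nucleus_addE qadd0l nucleus_fix.
Qed.

Lemma nucleus_plus0r : right_id nucleus_zero nucleus_plus.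
Proof.
move=> x; apply: val_inj => /=.
by rewrite -[in LHS](nucleus_fix x) nucleus_addE qadd0r nucleus_fix.
Qed.

Lemma le_nucleus_plus (x x' y y' : nucleus_image) :
  x <= x' -> y <= y' -> nucleus_plus x y <= nucleus_plus x' y'.
Proof.
rewrite !le_nucleus_imageE => xx' yy'.
by apply: nucleus_le; exact: le_qadd.
Qed.

Lemma nucleus_joinDl (X : set nucleus_image) (y : nucleus_image) :
  joinable s X -> nucleus_plus (nucleus_join X) y =
                  nucleus_join [set nucleus_plus x y | x in X].
Proof.
move=> jX; have jvX := joinable_image (val : nucleus_image -> Q) jX.
apply: val_inj => /=.
rewrite -[in LHS](nucleus_fix y) nucleus_addE qjoinDl//.
rewrite -[LHS]nucleus_joinE; last exact: joinable_image.
by rewrite !image_comp.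
Qed.

Lemma nucleus_joinDr (X : set nucleus_image) (y : nucleus_image) :
  joinable s X -> nucleus_plus y (nucleus_join X) =
                  nucleus_join [set nucleus_plus y x | x in X].
Proof.
move=> jX; have jvX := joinable_image (val : nucleus_image -> Q) jX.
apply: val_inj => /=.
rewrite -[in LHS](nucleus_fix y) nucleus_addE qjoinDr//.
rewrite -[LHS]nucleus_joinE; last exact: joinable_image.
by rewrite !image_comp.
Qed.

HB.instance Definition _ :=
  isQuantale.Build s d nucleus_image nucleus_joinP nucleus_plusA
    nucleus_plus0l nucleus_plus0r le_nucleus_plus nucleus_joinDl nucleus_joinDr.

Lemma le_nucleus_scale (a b : A) (x y : nucleus_image) :
  a <= b -> x <= y -> nucleus_scale a x <= nucleus_scale b y.
Proof.
rewrite !le_nucleus_imageE => ab xy.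
by apply: nucleus_le; exact: le_act.
Qed.

Lemma nucleus_scaleM (a b : A) (x : nucleus_image) :
  nucleus_scale (a * b) x = nucleus_scale a (nucleus_scale b x).
Proof. by apply: val_inj; rewrite /= nucleus_actE actM. Qed.

Lemma nucleus_scale1 (x : nucleus_image) : nucleus_scale 1 x = x.
Proof. by apply: val_inj; rewrite /= act1 nucleus_fix. Qed.

Lemma nucleus_scaleDl (a b : A) (x : nucleus_image) :
  nucleus_scale (a + b) x = nucleus_scale a x + nucleus_scale b x.
Proof. by apply: val_inj; rewrite /= nucleus_addE actDl. Qed.

Lemma nucleus_scale0 (x : nucleus_image) : nucleus_scale 0 x = 0.
Proof. by apply: val_inj; rewrite /= act0. Qed.

Lemma nucleus_scale_joinl (X : set A) (x : nucleus_image) : joinable s X ->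
  nucleus_scale (qjoin X) x = qjoin [set nucleus_scale a x | a in X].
Proof.
move=> jX; apply: val_inj => /=.
rewrite act_joinl// -[LHS]nucleus_joinE; last exact: joinable_image.
by rewrite !image_comp.
Qed.

Lemma nucleus_scale_iotaD (e : Ad) (x y : nucleus_image) :
  nucleus_scale (iota e) (x + y) =
  nucleus_scale (iota e) x + nucleus_scale (iota e) y.
Proof.
by apply: val_inj; rewrite /= nucleus_addE nucleus_actE act_iotaD.
Qed.

Lemma nucleus_scale_iota0 (e : Ad) :
  nucleus_scale (iota e) (0 : nucleus_image) = 0.
Proof. by apply: val_inj; rewrite /= nucleus_actE act_iota0. Qed.

Lemma nucleus_scale_iota_join (e : Ad) (X : set nucleus_image) :
  joinable s X -> nucleus_scale (iota e) (qjoin X) =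
                  qjoin [set nucleus_scale (iota e) x | x in X].
Proof.
move=> jX; have jvX := joinable_image (val : nucleus_image -> Q) jX.
apply: val_inj => /=.
rewrite nucleus_actE act_iota_join// -[LHS]nucleus_joinE;
  last exact: joinable_image.
by rewrite !image_comp.
Qed.

HB.instance Definition _ :=
  isModule.Build Ad s dA A d nucleus_image le_nucleus_scale nucleus_scaleM
    nucleus_scale1 nucleus_scaleDl nucleus_scale0 nucleus_scale_joinl
    nucleus_scale_iotaD nucleus_scale_iota0 nucleus_scale_iota_join.

End NucleusImage.

(* Main.v *)
Require Import Defs.
From mathcomp Require Import all_boot all_order.
From mathcomp Require Import monoid boolp classical_sets.

(** A generator [u] of a cyclic module [Q] induces the structural nucleus
    sending [a] to the join of all [b] with [b *: u <= a *: u].  It satisfies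
    [b <= g a] iff [b *: u <= a *: u], so [a *: u |-> g a] is a well-defined
    isomorphism from [Q] onto [A_g].  Conversely [A_g] is generated by [g 1]. *)

Set Implicit Arguments.
Unset Strict Implicit.
Unset Printing Implicit Defensive.

Import Order.TTheory.
Local Open Scope classical_set_scope.
Local Open Scope group_scope.
Local Open Scope order_scope.
Local Open Scope quantale_scope.

Section OrbitNucleus.
Context (s : setting) (Ad : monoidType) (dA : Order.disp_t).
Context (A : dgAdditiveQuantaleType Ad s dA).
Context (dQ : Order.disp_t) (Q : moduleType A dQ) (u : Q).
Implicit Types (a b : A).

(** This is the residual of [a *: u] by [u]. *)
Definition orbit_closure (a : A) : A := qjoin [set b : A | b *: u <= a *: u].

(** The set contains [a] itself, so its join is specified in the generalized setting too. *)
Lemma joinable_orbit a : joinable s [set b : A | b *: u <= a *: u].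
Proof. by case: s A Q u a => // A' Q' u' a; exists a => /=. Qed.

(** The action on [u] preserves joins, so the join of all [b] with [b *: u <= a *: u] still acts
    below [a *: u]; conversely [a] is one of these [b]. *)
Lemma orbit_closure_act a : orbit_closure a *: u = a *: u.
Proof.
apply/le_anti/andP; split.
  rewrite act_joinl; last exact: joinable_orbit.
  apply: qjoin_le; first exact/joinable_image/joinable_orbit.
  by move=> _ [b bau <-].
by apply: le_act => //; apply: le_qjoin => /=; first exact: joinable_orbit.
Qed.

(** Together with [orbit_closure_act], this turns the nucleus inequalities into comparisons in [Q]
    of elements acting on [u]. *)
Lemma le_orbit_closure a b : (b <= orbit_closure a) = (b *: u <= a *: u).
Proof.
apply/idP/idP => [ba|bau].
  by rewrite -(orbit_closure_act a); exact: le_act.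
by apply: le_qjoin => //; exact: joinable_orbit.
Qed.

Lemma orbit_closure_homo :
  {homo orbit_closure : x y / (x : regular_module A) <= y}.
Proof.
move=> a b ab; rewrite le_orbit_closure orbit_closure_act.
exact: le_act.
Qed.

Lemma orbit_closure_ge (a : regular_module A) : a <= orbit_closure a.
Proof. by rewrite le_orbit_closure. Qed.

Lemma orbit_closure_idem (a : regular_module A) :
  orbit_closure (orbit_closure a) = orbit_closure a.
Proof. by rewrite /orbit_closure orbit_closure_act. Qed.

Lemma orbit_closure_add (a b : regular_module A) :
  (orbit_closure a : regular_module A) + orbit_closure b
    <= orbit_closure (a + b).
Proof. by rewrite le_orbit_closure !actDl !orbit_closure_act. Qed.

Lemma orbit_closure_mul a (x : regular_module A) :
  a *: (orbit_closure x : regular_module A) <= orbit_closure (a *: x).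
Proof. by rewrite le_orbit_closure !actM orbit_closure_act. Qed.

Definition orbit_nucleus : structural_nucleus (regular_module A) :=
  @StructuralNucleus Ad s dA A dA (regular_module A) orbit_closure
    orbit_closure_homo orbit_closure_ge orbit_closure_idem orbit_closure_add
    orbit_closure_mul.

Lemma le_orbit_proj a b :
  (nucleus_proj orbit_nucleus a <= nucleus_proj orbit_nucleus b)
  = (a *: u <= b *: u).
Proof. by rewrite le_nucleus_imageE /= le_orbit_closure orbit_closure_act. Qed.

Lemma eq_orbit_proj a b : a *: u = b *: u ->
  nucleus_proj orbit_nucleus a = nucleus_proj orbit_nucleus b.
Proof. by move=> ab; apply/le_anti; rewrite !le_orbit_proj ab lexx. Qed.

(** The section [c] picks representatives. By [eq_orbit_proj] the choice is immaterial, so the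
    representative of a sum, join or scalar multiple may be replaced by the same operation on
    representatives. *)
Lemma orbit_nucleus_iso (c : Q -> A) : (forall x, c x *: u = x) ->
  module_iso (fun x => nucleus_proj orbit_nucleus (c x)).
Proof.
move=> cK; split.
(* The inverse lets a closed element act on [u]. *)
- exists (fun x => (val x : A) *: u) => [x|x] /=.
    by rewrite orbit_closure_act cK.
  have -> : nucleus_proj orbit_nucleus (c ((val x : A) *: u))
            = nucleus_proj orbit_nucleus (val x).
    by apply: eq_orbit_proj; rewrite cK.
  by apply: val_inj; rewrite /= -[RHS](nucleus_fix x).
- by move=> x y; rewrite le_orbit_proj !cK.
- move=> X jX; rewrite (@eq_orbit_proj _ (qjoin (c @` X))).
    apply: val_inj => /=.
    (* Closing each member first does not change the closure of a join. *)
    rewrite -[LHS](nucleus_joinE orbit_nucleus (joinable_image c jX)).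
    by rewrite !image_comp.
  rewrite cK act_joinl; last exact: joinable_image.
  rewrite image_comp; congr qjoin; rewrite -[LHS]image_id.
  by apply: eq_imagel => x _; rewrite /= cK.
- move=> x y; rewrite (@eq_orbit_proj _ (c x + c y)).
    by apply: val_inj; rewrite /= -[LHS](nucleus_addE orbit_nucleus).
  by rewrite actDl !cK.
- by apply: eq_orbit_proj; rewrite cK act0.
- move=> a x; rewrite (@eq_orbit_proj _ (a * c x)).
    by apply: val_inj; rewrite /= -[LHS](nucleus_actE orbit_nucleus a (c x)).
  by rewrite actM !cK.
Qed.

End OrbitNucleus.

(** The outer nucleus absorbs the inner one: [g (x * g 1) = g (x * 1) = g x], and [x] is closed. *)
Lemma nucleus_image_generated (s : setting) (Ad : monoidType)
    (dA : Order.disp_t) (A : dgAdditiveQuantaleType Ad s dA)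
    (g : structural_nucleus (regular_module A)) (x : nucleus_image g) :
  (val x : A) *: nucleus_proj g (1 : A) = x.
Proof.
apply: val_inj; rewrite /= nucleus_actE -[RHS]nucleus_fix.
by congr (g _); exact: mulg1.
Qed.

(** The generator is pulled back along the inverse isomorphism. *)
Lemma cyclic_isomorphic (s : setting) (Ad : monoidType)
    (dA : Order.disp_t) (A : additiveQuantaleType Ad s dA)
    (d d' : Order.disp_t) (Q : moduleType A d) (Q' : moduleType A d') :
  isomorphic Q Q' -> cyclic Q' -> cyclic Q.
Proof.
move=> [f fiso] [v vgen]; have [h fK hK] := module_iso_bij fiso.
exists (h v); apply/seteqP; split=> // x _.
have [a _ av] : range (fun a : A => a *: v) (f x) by rewrite vgen.
by exists a => //; rewrite -[RHS]fK -av -[in RHS](hK v) -(module_iso_act fiso) fK.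
Qed.

Theorem theorem6p7 (s : setting) (Ad : monoidType) (dA : Order.disp_t)
    (A : dgAdditiveQuantaleType Ad s dA)
    (dQ : Order.disp_t) (Q : moduleType A dQ) :
  cyclic Q <->
  exists g : structural_nucleus (regular_module A),
    isomorphic Q (nucleus_image g).
Proof.
split=> [[u ugen]|[g Qg]].
  (* Cyclicity makes the action on [u] surjective; choice provides a section. *)
  have /choice[c cK] (x : Q) : exists a : A, a *: u = x.
    have [a _ ax] : range (fun a : A => a *: u) x by rewrite ugen.
    by exists a.
  exists (orbit_nucleus u), (fun x => nucleus_proj (orbit_nucleus u) (c x)).
  exact: orbit_nucleus_iso.
apply: cyclic_isomorphic Qg _; exists (nucleus_proj g (1 : A)).
apply/seteqP; split=> // x _; exists (val x) => //.
exact: nucleus_image_generated.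
Qed.
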